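(* Let $Q$ be a cyclic hyperbolic quadrilateral with side lengths $a,b,c,d$. Then the area $S=S(Q)$ is given by the formula $$\sin^2\frac{S}{2}=\frac{\sinh(s-a)\sinh(s-b)\sinh(s-c)\sinh(s-d)}{4\cosh^2\frac{a}{2}\cosh^2\frac{b}{2}\cosh^2\frac{c}{2}\cosh^2\frac{d}{2}}\,(1-\varepsilon),$$ where $$\varepsilon=\frac{\sinh\frac{a}{2}\sinh\frac{b}{2}\sinh\frac{c}{2}\sinh\frac{d}{2}}{\cosh\frac{s-a}{2}\cosh\frac{s-b}{2}\cosh\frac{s-c}{2}\cosh\frac{s-d}{2}}\quad\text{and}\quad s=\frac{a+b+c+d}{2}.$$
   Context: The hyperbolic plane carries the Riemannian metric of constant curvature $-1$. A cyclic polygon in the hyperbolic plane is a convex polygon inscribed in a circle, a horocycle, or one branch of an equidistant curve. *)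

(* Defs.v *)
From mathcomp Require Import all_boot all_order all_algebra.
From mathcomp Require Import all_classical all_reals all_analysis.
Import Order.TTheory GRing.Theory Num.Theory.
Import numFieldNormedType.Exports.

Set Implicit Arguments.
Unset Strict Implicit.
Unset Printing Implicit Defensive.

Local Open Scope classical_set_scope.
Local Open Scope ring_scope.

(* The hyperbolic plane of curvature -1 is the upper half-plane
   { (x, y) | 0 < y } with the metric (dx ^ 2 + dy ^ 2) / y ^ 2. *)

Section HyperbolicPlane.
Context {R : realType}.
Implicit Types (P Q V z w : R * R) (A B C D : R * R).

Definition cosh (t : R) : R := (expR t + expR (- t)) / 2.
Definition sinh (t : R) : R := (expR t - expR (- t)) / 2.
(* Meaningful for 1 <= t. *)
Definition arcosh (t : R) : R := ln (t + Num.sqrt (t ^+ 2 - 1)).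

Definition hplane : set (R * R) := [set z | 0 < z.2].

Definition sqnorm z : R := z.1 ^+ 2 + z.2 ^+ 2.

(* Closed form of the geodesic distance of the metric. *)
Definition hdist z w : R :=
  arcosh (1 + sqnorm (z - w) / (2 * z.2 * w.2)).

(* The Riemannian area element of the metric is dx dy / y ^ 2. *)
Definition harea (K : set (R * R)) : R :=
  \int[(@lebesgue_measure R \x @lebesgue_measure R)%E]_(z in K) (z.2 ^- 2).

(* For P != Q, the zero set of [side P Q] is the vertical line or the circle
   centred on the real axis that passes through P and Q, so its trace on the
   half-plane is the geodesic line PQ; the sign of [side P Q] separates the two
   sides of that line (it is positive on the left when going from P to Q). *)
Definition side P Q z : R :=
  (Q.1 - P.1) * (sqnorm z - sqnorm P) - (sqnorm Q - sqnorm P) * (z.1 - P.1).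

Definition hline P Q : set (R * R) := [set z | hplane z /\ side P Q z = 0].

(* The closed half-plane bounded by the line PQ that contains V. *)
Definition half_plane P Q V : set (R * R) :=
  [set z | hplane z /\ 0 <= side P Q z * side P Q V].

Definition is_circle (K : set (R * R)) : Prop :=
  exists o (r : R), [/\ hplane o, 0 < r
    & K = [set z | hplane z /\ hdist z o = r]].

(* Horocycles centred at the ideal point oo, then at the ideal point p on the
   real axis. *)
Definition is_horocycle (K : set (R * R)) : Prop :=
  (exists2 k : R, 0 < k & K = [set z | z.2 = k]) \/
  (exists p k : R, 0 < k /\
    K = [set z | hplane z /\ (z.1 - p) ^+ 2 + z.2 ^+ 2 = k * z.2]).

Definition dist_to_line P Q z : R := inf [set hdist z w | w in hline P Q].

(* Exchanging P and Q gives the branch on the other side of the line. *)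
Definition is_equidistant_branch (K : set (R * R)) : Prop :=
  exists P Q (h : R), [/\ hplane P, hplane Q, P != Q, 0 < h
    & K = [set z | [/\ hplane z, 0 < side P Q z & dist_to_line P Q z = h]]].

Definition is_cycle (K : set (R * R)) : Prop :=
  [\/ is_circle K, is_horocycle K | is_equidistant_branch K].

(* Vertices are listed in cyclic order: the line through each side has the two
   remaining vertices strictly on the same side. *)
Definition convex_quadrilateral A B C D : Prop :=
  [/\ hplane A, hplane B, hplane C & hplane D] /\
  [/\ 0 < side A B C * side A B D, 0 < side B C D * side B C A,
      0 < side C D A * side C D B & 0 < side D A B * side D A C].

Definition quadrilateral A B C D : set (R * R) :=
  half_plane A B C `&` half_plane B C D `&` half_plane C D A
    `&` half_plane D A B.

Definition cyclic_quadrilateral A B C D : Prop :=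
  convex_quadrilateral A B C D /\
  exists2 K, is_cycle K & [/\ K A, K B, K C & K D].

End HyperbolicPlane.

(* Main.v *)
Require Import Defs.
From mathcomp Require Import all_boot all_order all_algebra.
From mathcomp Require Import all_classical all_reals all_analysis.
From mathcomp Require Import measurable_realfun ring lra.
Import Order.TTheory GRing.Theory Num.Theory.
Import numFieldNormedType.Exports.

(** The half-area is the argument of an explicit complex number, whose real part
    can be computed.

    In the coordinates (x, n) with n = x^2 + y^2, the half-plane is the region
    n > x^2 inside a parabola, geodesics are straight segments, and [side] is
    the affine orientation determinant.  The region above a geodesic arc PQ has area
    2 arg (turn P Q), where turn P Q = (P - cconj Q) / 'i
    ([integral_above]).  Off finitely many verticals, the indicator of a convex
    quadrilateral is the signed sum of the indicators of the regions above its
    sides ([cross_quadrilateral]), so the area S satisfies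
    S / 2 = arg (turn A B) + arg (turn B C) + arg (turn C D) + arg (turn D A)
    up to the orientation ([cos_half_area]).  Since turn P Q has modulus
    2 sqrt (yP yQ) cosh (PQ / 2), this gives cos (S / 2) as the real part of the
    product of the four turns ([holonomy]) over
    16 yA yB yC yD cosh (a / 2) cosh (b / 2) cosh (c / 2) cosh (d / 2).

    For arbitrary four points, that real part is a polynomial in the heights and
    the squared Euclidean sides, plus the real part of
    (A - B) cconj (B - C) (C - D) cconj (D - A) ([re_holonomy]).  On a cycle the
    heights are an affine function of (x, n) ([cycle_section]), so the vertices
    lie on a Euclidean circle or line; then this last product is real, and
    convexity makes it negative ([im_chords], [re_chords_lt0]).  As
    sinh (a / 2) = |A - B| / (2 sqrt (yA yB)), it equals
    - 16 yA yB yC yD Sa Sb Sc Sd, where Sa = sinh (a / 2) and so on.  Hence,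
    with Ca = cosh (a / 2) and so on, [cos_half_area_cyclic] gives up to sign
      cos (S / 2) = (1 + (Sa^2 + Sb^2 + Sc^2 + Sd^2) / 2 - Sa Sb Sc Sd)
                    / (Ca Cb Cc Cd).
    Finally 1 - cos^2 (S / 2) factors as in Heron's formula for a triangle with
    sides Sa Sb + Sc Sd, Ca Cb and Cc Cd, and the two factors are the sinh and
    cosh products of the theorem ([brahmagupta_of_cos]). *)

Local Open Scope classical_set_scope.
Local Open Scope ring_scope.

Set Implicit Arguments.
Unset Strict Implicit.

(** * Hyperbolic functions and the distance *)

Section HyperbolicTrigonometry.
Context {R : realType}.
Implicit Types (x y t : R) (z w : R * R).

Lemma cosh_gt0 x : 0 < cosh x.
Proof. by rewrite /cosh divr_gt0// addr_gt0// expR_gt0. Qed.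

Lemma cosh2_sinh2 x : cosh x ^+ 2 = 1 + sinh x ^+ 2.
Proof.
rewrite /cosh /sinh expRN; have := expR_gt0 x; move: (expR x) => e e0.
by field; rewrite gt_eqF.
Qed.

Lemma coshD x y : cosh (x + y) = cosh x * cosh y + sinh x * sinh y.
Proof.
rewrite /cosh /sinh opprD !expRD !expRN.
have := expR_gt0 x; have := expR_gt0 y.
by move: (expR x) (expR y) => e f e0 f0; field; rewrite !gt_eqF.
Qed.

Lemma coshN x : cosh (- x) = cosh x.
Proof. by rewrite /cosh opprK addrC. Qed.

Lemma sinhN x : sinh (- x) = - sinh x.
Proof. by rewrite /sinh opprK -mulNr opprB. Qed.

Lemma coshB x y : cosh (x - y) = cosh x * cosh y - sinh x * sinh y.
Proof. by rewrite coshD coshN sinhN mulrN. Qed.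

Lemma sinh_double x : sinh x = 2 * sinh (x / 2) * cosh (x / 2).
Proof.
rewrite {1}(_ : x = x / 2 + x / 2); last by field.
rewrite /cosh /sinh opprD !expRD !expRN.
have := expR_gt0 (x / 2); move: (expR _) => e e0.
by field; rewrite !gt_eqF.
Qed.

Lemma cosh_double x : cosh x = 1 + 2 * sinh (x / 2) ^+ 2.
Proof.
rewrite {1}(_ : x = x / 2 + x / 2); last by field.
by rewrite coshD -!expr2 cosh2_sinh2; ring.
Qed.

Lemma sinh_ge0 x : 0 <= x -> 0 <= sinh x.
Proof.
by move=> x0; rewrite /sinh divr_ge0// subr_ge0 ler_expR; lra.
Qed.

Lemma sinh_gt0 x : 0 < x -> 0 < sinh x.
Proof.
by move=> x0; rewrite /sinh divr_gt0// subr_gt0 ltr_expR; lra.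
Qed.

Lemma arcosh_ge0 t : 1 <= t -> 0 <= arcosh t.
Proof.
by move=> t1; rewrite /arcosh ln_ge0// (le_trans t1)// lerDl sqrtr_ge0.
Qed.

Lemma cosh_arcosh t : 1 <= t -> cosh (arcosh t) = t.
Proof.
move=> t1; rewrite /cosh expRN /arcosh.
have r0 := sqrtr_ge0 (t ^+ 2 - 1).
have r2 : Num.sqrt (t ^+ 2 - 1) ^+ 2 = t ^+ 2 - 1 by rewrite sqr_sqrtr//; nra.
move: (Num.sqrt _) r0 r2 => r r0 r2.
have e0 : 0 < t + r by lra.
rewrite lnK ?posrE//.
have -> : (t + r)^-1 = t - r.
  by apply: (mulfI (lt0r_neq0 e0)); rewrite divff ?gt_eqF//; nra.
by field.
Qed.

Lemma sqnorm_ge0 z : 0 <= sqnorm z.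
Proof. by rewrite /sqnorm addr_ge0// sqr_ge0. Qed.

Section Distance.
Variables z w : R * R.
Hypotheses (z0 : hplane z) (w0 : hplane w).

Let t_ge1 : 1 <= 1 + sqnorm (z - w) / (2 * z.2 * w.2).
Proof.
by rewrite lerDl divr_ge0 ?sqnorm_ge0// mulr_ge0 ?mulr_ge0// ltW.
Qed.

Lemma hdist_ge0 : 0 <= hdist z w.
Proof. exact: arcosh_ge0. Qed.

Lemma cosh_hdist : cosh (hdist z w) = 1 + sqnorm (z - w) / (2 * z.2 * w.2).
Proof. exact: cosh_arcosh. Qed.

Lemma sinh_half_hdist_ge0 : 0 <= sinh (hdist z w / 2).
Proof. by rewrite sinh_ge0// divr_ge0// hdist_ge0. Qed.

(** All side lengths enter through this formula: up to the heights of its end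
    points, the hyperbolic sine of half a side is its Euclidean length. *)
Lemma sinh_half_hdist :
  sinh (hdist z w / 2) ^+ 2 = sqnorm (z - w) / (4 * z.2 * w.2).
Proof.
have := cosh_hdist; rewrite cosh_double => /addrI e.
apply: (@mulfI _ 2); first by rewrite pnatr_eq0.
rewrite e; have: 0 < z.2 by []. have: 0 < w.2 by [].
by move=> *; field; rewrite !gt_eqF.
Qed.

End Distance.

Section QuarterPerimeter.
Variables a b c d : R.
Let s := (a + b + c + d) / 2.
Let Sa := sinh (a / 2). Let Sb := sinh (b / 2).
Let Sc := sinh (c / 2). Let Sd := sinh (d / 2).
Let Ca := cosh (a / 2). Let Cb := cosh (b / 2).
Let Cc := cosh (c / 2). Let Cd := cosh (d / 2).

Let sinhM x y : sinh x * sinh y = (cosh (x + y) - cosh (x - y)) / 2.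
Proof. by rewrite coshB coshD; field. Qed.

Let coshM x y : cosh x * cosh y = (cosh (x + y) + cosh (x - y)) / 2.
Proof. by rewrite coshB coshD; field. Qed.

(** Pairing the factors by the product-to-sum formulas makes the quarter
    arguments disappear: (s - a) / 2 and (s - b) / 2 have sum (c + d) / 2 and
    difference (b - a) / 2. *)
Lemma prod_sinh_quarter :
  sinh ((s - a) / 2) * sinh ((s - b) / 2) * sinh ((s - c) / 2) *
    sinh ((s - d) / 2) =
  ((Sa * Sb + Sc * Sd) ^+ 2 - (Ca * Cb - Cc * Cd) ^+ 2) / 4.
Proof.
rewrite sinhM -mulrA sinhM.
have -> : (s - a) / 2 + (s - b) / 2 = c / 2 + d / 2 by rewrite /s; field.
have -> : (s - a) / 2 - (s - b) / 2 = b / 2 - a / 2 by rewrite /s; field.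
have -> : (s - c) / 2 + (s - d) / 2 = a / 2 + b / 2 by rewrite /s; field.
have -> : (s - c) / 2 - (s - d) / 2 = d / 2 - c / 2 by rewrite /s; field.
by rewrite !coshB !coshD -/Sa -/Sb -/Sc -/Sd -/Ca -/Cb -/Cc -/Cd; field.
Qed.

Lemma prod_cosh_quarter :
  cosh ((s - a) / 2) * cosh ((s - b) / 2) * cosh ((s - c) / 2) *
    cosh ((s - d) / 2) =
  ((Ca * Cb + Cc * Cd) ^+ 2 - (Sa * Sb - Sc * Sd) ^+ 2) / 4.
Proof.
rewrite coshM -mulrA coshM.
have -> : (s - a) / 2 + (s - b) / 2 = c / 2 + d / 2 by rewrite /s; field.
have -> : (s - a) / 2 - (s - b) / 2 = b / 2 - a / 2 by rewrite /s; field.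
have -> : (s - c) / 2 + (s - d) / 2 = a / 2 + b / 2 by rewrite /s; field.
have -> : (s - c) / 2 - (s - d) / 2 = d / 2 - c / 2 by rewrite /s; field.
by rewrite !coshB !coshD -/Sa -/Sb -/Sc -/Sd -/Ca -/Cb -/Cc -/Cd; field.
Qed.

(** The left-hand side is sin (S / 2) ^+ 2 as soon as the square on the right is
    cos (S / 2) ^+ 2.  With X = Sa Sb + Sc Sd, Y = Ca Cb and Z = Cc Cd, the
    numerator of the cosine is (Y^2 + Z^2 - X^2) / 2, so the law of cosines and
    Heron's factorization give 1 - cos^2 as the product of X^2 - (Y - Z)^2 and
    (Y + Z)^2 - X^2 over 4 Y^2 Z^2; the first factor is the product of the
    sinh ((s - a) / 2), the second one that of the cosh ((s - a) / 2) minus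
    Sa Sb Sc Sd, each up to the factor 4. *)
Lemma brahmagupta_of_cos :
  (sinh (s - a) * sinh (s - b) * sinh (s - c) * sinh (s - d)) /
    (4 * Ca ^+ 2 * Cb ^+ 2 * Cc ^+ 2 * Cd ^+ 2) *
    (1 - (Sa * Sb * Sc * Sd) /
         (cosh ((s - a) / 2) * cosh ((s - b) / 2) *
          cosh ((s - c) / 2) * cosh ((s - d) / 2))) =
  1 - (1 + (Sa ^+ 2 + Sb ^+ 2 + Sc ^+ 2 + Sd ^+ 2) / 2 - Sa * Sb * Sc * Sd) ^+ 2
      / (Ca ^+ 2 * Cb ^+ 2 * Cc ^+ 2 * Cd ^+ 2).
Proof.
set K := cosh ((s - a) / 2) * _ * _ * _.
have c0 (x : R) : cosh x != 0 by rewrite gt_eqF// cosh_gt0.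
have K0 : K != 0 by exact: mulf_neq0 (mulf_neq0 (mulf_neq0 (c0 _) (c0 _)) (c0 _)) (c0 _).
have -> : sinh (s - a) * sinh (s - b) * sinh (s - c) * sinh (s - d) =
    16 * ((Sa * Sb + Sc * Sd) ^+ 2 - (Ca * Cb - Cc * Cd) ^+ 2) / 4 * K.
  rewrite -(mulrA 16) -prod_sinh_quarter /K.
  by rewrite !(sinh_double (s - _)); ring.
set P := 4 * _ * _ * _ * _.
have cancel_K (N T : R) : N * K / P * (1 - T / K) = N / P * (K - T).
  move: K K0 P => k k0 p; rewrite [N * k / p]mulrAC -(mulrA (N / p)); congr (_ * _).
  by rewrite mulrBr mulr1 (mulrC _ (_ / k)) divfK.
have eK : K = ((Ca * Cb + Cc * Cd) ^+ 2 - (Sa * Sb - Sc * Sd) ^+ 2) / 4.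
  exact: prod_cosh_quarter.
rewrite cancel_K.
have ca : Ca ^+ 2 = 1 + Sa ^+ 2 by exact: cosh2_sinh2.
have cb : Cb ^+ 2 = 1 + Sb ^+ 2 by exact: cosh2_sinh2.
have cc : Cc ^+ 2 = 1 + Sc ^+ 2 by exact: cosh2_sinh2.
have cd : Cd ^+ 2 = 1 + Sd ^+ 2 by exact: cosh2_sinh2.
(* X, Ca * Cb and Cc * Cd play the part of the sides of Heron's triangle. *)
pose X := Sa * Sb + Sc * Sd.
have -> : 1 + (Sa ^+ 2 + Sb ^+ 2 + Sc ^+ 2 + Sd ^+ 2) / 2 - Sa * Sb * Sc * Sd =
    ((Ca * Cb) ^+ 2 + (Cc * Cd) ^+ 2 - X ^+ 2) / 2.
  rewrite (_ : (Ca * Cb) ^+ 2 = Ca ^+ 2 * Cb ^+ 2); last by ring.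
  rewrite (_ : (Cc * Cd) ^+ 2 = Cc ^+ 2 * Cd ^+ 2); last by ring.
  by rewrite ca cb cc cd /X; field.
rewrite eK /P /X /Ca /Cb /Cc /Cd.
by field; rewrite !c0.
Qed.

End QuarterPerimeter.
End HyperbolicTrigonometry.

(** * Orientation of triangles *)

Section Side.
Context {R : realType}.
Implicit Types P Q z : R * R.

Lemma sideN P Q z : side Q P z = - side P Q z.
Proof. by rewrite /side /sqnorm; ring. Qed.

Lemma side_cycle P Q z : side P Q z = side Q z P.
Proof. by rewrite /side /sqnorm; ring. Qed.

End Side.

(** * The four vertices as complex numbers *)

Section CyclicAlgebra.
Context {R : realType}.
Implicit Types (u v A B C D P Q z w : R * R).

(** Points of the plane are multiplied as complex numbers. *)
Definition cmul u v : R * R :=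
  (u.1 * v.1 - u.2 * v.2, u.1 * v.2 + u.2 * v.1).
Definition cconj u : R * R := (u.1, - u.2).

Lemma sqnorm_cmul u v : sqnorm (cmul u v) = sqnorm u * sqnorm v.
Proof. by rewrite /sqnorm /cmul /=; ring. Qed.

Lemma sqnorm_cconj u : sqnorm (cconj u) = sqnorm u.
Proof. by rewrite /sqnorm /cconj /=; ring. Qed.

(** This is P - cconj Q divided by 'i.  Its modulus is
    2 sqrt (yP yQ) cosh (PQ / 2), and its argument is half the angle under which
    the arc PQ is seen from the centre of its circle. *)
Definition turn P Q : R * R := (P.2 + Q.2, Q.1 - P.1).

Definition holonomy A B C D : R * R :=
  cmul (cmul (turn A B) (turn B C)) (cmul (turn C D) (turn D A)).

(** Up to a positive factor this is the cross-ratio of the four points. *)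
Definition chords A B C D : R * R :=
  cmul (cmul (A - B) (cconj (B - C))) (cmul (C - D) (cconj (D - A))).

(** Replacing P - cconj Q by P - Q in the product of the four factors, and
    conjugating every second one, changes its real part by a polynomial in the
    heights and the squared sides. *)
Lemma re_holonomy A B C D :
  (holonomy A B C D).1 =
  16 * A.2 * B.2 * C.2 * D.2 +
  2 * (sqnorm (A - B) * C.2 * D.2 + sqnorm (B - C) * D.2 * A.2 +
       sqnorm (C - D) * A.2 * B.2 + sqnorm (D - A) * B.2 * C.2) +
  (chords A B C D).1.
Proof.
case: A B C D => [? ?] [? ?] [? ?] [? ?].
by rewrite /holonomy /chords /turn /cmul /cconj /sqnorm /=; ring.
Qed.

(** A cycle is the set of points with y = al + be x + ga (x^2 + y^2), that is
    a Euclidean circle, or a Euclidean line when ga = 0. *)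
Section OnCycle.
Variables (al be ga : R) (A B C D : R * R).
Let on_cycle z := z.2 = al + be * z.1 + ga * sqnorm z.
Hypotheses (hA : on_cycle A) (hB : on_cycle B).
Hypotheses (hC : on_cycle C) (hD : on_cycle D).

(** The left-hand side is the orientation of the triangle in the coordinates
    (x, y), while side is the one in the coordinates (x, x^2 + y^2); eliminating
    y by the equation of the cycle turns one into a multiple of the other. *)
Let im_pair P Q z : on_cycle P -> on_cycle Q -> on_cycle z ->
  (cmul (P - Q) (cconj (Q - z))).2 = - ga * side P Q z.
Proof.
move=> hP hQ hz.
transitivity ((P.1 - Q.1) * (z.2 - P.2) - (z.1 - P.1) * (P.2 - Q.2)).
  by rewrite /cmul /cconj /=; ring.
by rewrite hP hQ hz /side; ring.
Qed.

(** The imaginary part of the cross-ratio is the determinant of the rows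
    (1, x, y, x^2 + y^2), and the equation of the cycle is a linear relation
    between its columns. *)
Lemma im_chords : (chords A B C D).2 = 0.
Proof.
pose vol (a b c : R * R * R) := a.1.1 * (b.1.2 * c.2 - b.2 * c.1.2)
  - a.1.2 * (b.1.1 * c.2 - b.2 * c.1.1) + a.2 * (b.1.1 * c.1.2 - b.1.2 * c.1.1).
pose col P := (P.1 - A.1, P.2 - A.2, sqnorm P - sqnorm A).
transitivity (vol (col B) (col C) (col D)).
  rewrite /vol /col; case: A B C D => [? ?] [? ?] [? ?] [? ?].
  by rewrite /chords /cmul /cconj /sqnorm /=; ring.
by rewrite /vol /col /= hA hB hC hD; ring.
Qed.

Hypotheses (hAB : 0 < side A B C * side A B D)
  (hBC : 0 < side B C D * side B C A)
  (hDA : 0 < side D A B * side D A C).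

(** A real cross-ratio has the sign that tells whether the diagonals separate
    the vertices.  On a circle the triangles ABC and CDA have the same Euclidean
    orientation, so the imaginary parts of the two factors have the same sign; as
    the product is real, it must be negative.  On a Euclidean line these
    imaginary parts vanish, and the sign comes from the order of the abscissae,
    on which x^2 + y^2 depends quadratically. *)
Lemma re_chords_lt0 : (chords A B C D).1 < 0.
Proof.
have [ga0|ga0] := eqVneq ga 0.
  have e P : on_cycle P -> P = (P.1, al + be * P.1).
    by rewrite /on_cycle ga0 mul0r addr0; case: P => p1 p2 /= ->.
  move: hAB hBC; rewrite (e _ hA) (e _ hB) (e _ hC) (e _ hD).
  rewrite /side /chords /cmul /cconj /sqnorm /=.
  move: A.1 B.1 C.1 D.1 => a b c d h1 h2.
  (* On the line y = al + be x the coefficient of x^2 in x^2 + y^2 is k, and the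
     product of h1 and h2 is minus a square times the product of the differences. *)
  pose k := 1 + be ^+ 2; have k0 : 0 < k by rewrite /k; nra.
  have : 0 < - (k ^+ 4 * ((c - a) * (d - b) * (b - a) * (c - b)) ^+ 2 *
    ((a - b) * (b - c) * (c - d) * (d - a))).
    have := mulr_gt0 h1 h2; set X := _ * _; set Y := - _.
    by have -> : X = Y by rewrite /X /Y /k; ring.
  rewrite oppr_gt0; set q := _ ^+ 4 * _ => hq.
  have q0 : 0 <= q by rewrite /q mulr_ge0 ?sqr_ge0// exprn_ge0// ltW.
  have {}hq : (a - b) * (b - c) * (c - d) * (d - a) < 0.
    by rewrite ltNge; apply/negP => /(mulr_ge0 q0); rewrite leNgt hq.
  have : k ^+ 2 * ((a - b) * (b - c) * (c - d) * (d - a)) < 0.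
    by rewrite nmulr_llt0// exprn_gt0.
  set X := _ * _; set Y := (X in _ -> X < 0).
  by have -> : X = Y by rewrite /X /Y /k; ring.
pose u := cmul (C - D) (cconj (D - A)); pose v := cmul (A - B) (cconj (B - C)).
have eu : u.2 = - ga * side C D A := im_pair hC hD hA.
have ev : v.2 = - ga * side A B C := im_pair hA hB hC.
have im0 : v.1 * u.2 + v.2 * u.1 = 0 := im_chords.
rewrite (_ : (chords A B C D).1 = v.1 * u.1 - v.2 * u.2)//.
have uv0 : 0 < u.2 * v.2.
  rewrite eu ev.
  have -> : side C D A = side D A C by exact: side_cycle.
  have := mulr_gt0 hAB hDA.
  have -> : side D A B = side A B D by exact: side_cycle.
  move: (side A B C) (side A B D) (side D A C) => p q r.
  have -> : p * q * (q * r) = q ^+ 2 * (p * r) by ring.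
  have -> : - ga * r * (- ga * p) = ga ^+ 2 * (p * r) by ring.
  rewrite [0 < ga ^+ 2 * _]pmulr_rgt0 ?exprn_even_gt0//.
  have [->|q0] := eqVneq q 0; first by rewrite expr0n/= mul0r ltxx.
  by rewrite pmulr_rgt0// exprn_even_gt0.
rewrite -(pmulr_llt0 _ uv0).
have -> : (v.1 * u.1 - v.2 * u.2) * (u.2 * v.2) =
    - ((v.1 * u.2) ^+ 2 + (u.2 * v.2) ^+ 2).
  rewrite -[RHS]addr0 -[X in _ = _ + X](mulr0 (v.1 * u.2)) -im0; ring.
by rewrite oppr_lt0 ltr_wpDl ?sqr_ge0// exprn_gt0.
Qed.

End OnCycle.
End CyclicAlgebra.

(** * Cycles in Cartesian coordinates *)

Section CyclesAreSections.
Context {R : realType}.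
Implicit Types (P Q z w : R * R) (K : set (R * R)) (x y : R).

Lemma cosh_ltr x y : 0 <= x -> x < y -> cosh x < cosh y.
Proof.
move=> x0 xy.
pose m := (y + x) / 2; pose k := (y - x) / 2.
have ex : x = m - k by rewrite /m /k; field.
have ey : y = m + k by rewrite /m /k; field.
have m0 : 0 < sinh m by apply: sinh_gt0; rewrite /m; lra.
have k0 : 0 < sinh k by apply: sinh_gt0; rewrite /k; lra.
by rewrite ex ey coshB coshD ltrD2l gtrN// mulr_gt0.
Qed.

Lemma cosh_hdistE z w : hplane z -> hplane w ->
  cosh (hdist z w) = (sqnorm z + sqnorm w - 2 * z.1 * w.1) / (2 * z.2 * w.2).
Proof.
move=> z0 w0; rewrite cosh_hdist//.
have: 0 < z.2 by []. have: 0 < w.2 by [].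
move=> w20 z20; rewrite /sqnorm /=.
by field; rewrite !gt_eqF.
Qed.

Section DistanceToLine.
Variables P Q z : R * R.
Hypotheses (P0 : hplane P) (Q0 : hplane Q) (PQ : P != Q) (z0 : hplane z).
Let p := Q.1 - P.1.
Let q := sqnorm Q - sqnorm P.
Let c := q * P.1 - p * sqnorm P.
Let f := side P Q z.

(** The line PQ is the zero set of p (x^2 + y^2) - q x + c, and this is its
    discriminant.  It is the square of the norm of the conormal of the line for
    the Lorentzian form that the parabola y = 0 defines. *)
Definition line_disc : R := q ^+ 2 - 4 * p * c.
Let Dl := line_disc.

Let sideE w : side P Q w = p * sqnorm w - q * w.1 + c.
Proof. by rewrite /side -/p -/q /c; ring. Qed.

Lemma line_disc_gt0 : 0 < line_disc.
Proof.
have P20 : 0 < P.2 by []. have Q20 : 0 < Q.2 by [].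
have -> : line_disc = (q - 2 * p * P.1) ^+ 2 + (2 * p * P.2) ^+ 2.
  by rewrite /line_disc /c /sqnorm; ring.
have [p0|p0] := eqVneq p 0; last first.
  by rewrite ltr_wpDl ?sqr_ge0// exprn_even_gt0//= !mulf_neq0 ?pnatr_eq0// gt_eqF.
rewrite p0 mulr0 !mul0r subr0 expr0n addr0 exprn_even_gt0//=.
have e1 : Q.1 = P.1 by apply/eqP; rewrite -subr_eq0; apply/eqP.
apply: contraNneq PQ; rewrite /q /sqnorm e1 => e.
have e2 : P.2 = Q.2.
  by apply: (@pexpIrn _ 2); rewrite ?nnegrE ?ltW//; lra.
by move: e1 e2; case: P Q => [? ?] [? ?] /= -> ->.
Qed.

Let G := 2 * p * f + Dl.
Let r := Num.sqrt (Dl * (Dl * z.2 ^+ 2 + f ^+ 2)).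

Let Dl0 : 0 < Dl. Proof. exact: line_disc_gt0. Qed.
Let z20 : 0 < z.2. Proof. by []. Qed.

Let G0 : 0 < G.
Proof.
have -> : G = 2 * p ^+ 2 * z.2 ^+ 2 + (2 * p * z.1 - q) ^+ 2 / 2 + Dl / 2.
  by rewrite /G /f sideE /Dl /line_disc /sqnorm; field.
have h1 := sqr_ge0 (p * z.2); have h2 := sqr_ge0 (2 * p * z.1 - q).
by move: Dl0; rewrite exprMn in h1; lra.
Qed.

Let r2 : r ^+ 2 = Dl * (Dl * z.2 ^+ 2 + f ^+ 2).
Proof.
have Dl1 := ltW Dl0.
by rewrite sqr_sqrtr// mulr_ge0// addr_ge0 ?sqr_ge0// mulr_ge0 ?sqr_ge0.
Qed.

Let r0 : 0 < r.
Proof.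
rewrite sqrtr_gt0 mulr_gt0// ltr_pwDl ?sqr_ge0// mulr_gt0//.
exact: exprn_gt0.
Qed.

(** The foot of the perpendicular: the point where the square found in the
    proof of the lower bound below vanishes. *)
Let foot : R * R := ((Dl * z.1 + q * f) / G, r / G).

Let foot_line : hline P Q foot.
Proof.
split; first by rewrite /hplane /foot /= divr_gt0.
rewrite sideE /sqnorm.
have -> : p * (foot.1 ^+ 2 + foot.2 ^+ 2) - q * foot.1 + c =
    (p * ((Dl * z.1 + q * f) ^+ 2 + r ^+ 2) - q * G * (Dl * z.1 + q * f) +
     c * G ^+ 2) / G ^+ 2.
  by rewrite /foot /=; move: (G) G0 => g g0; field; rewrite gt_eqF.
have fE : f = p * (z.1 ^+ 2 + z.2 ^+ 2) - q * z.1 + c by exact: sideE.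
rewrite r2 /G fE /Dl /line_disc; set N := (X in X / _).
have -> : N = 0 by rewrite /N; ring.
by rewrite mul0r.
Qed.

Let cosh_foot : cosh (hdist z foot) = r / (Dl * z.2).
Proof.
have [f0 _] := foot_line.
rewrite cosh_hdistE//.
have -> : sqnorm z + sqnorm foot - 2 * z.1 * foot.1 = 2 * r ^+ 2 / (G * Dl).
  have fE : f = p * (z.1 ^+ 2 + z.2 ^+ 2) - q * z.1 + c by exact: sideE.
  have -> : sqnorm z + sqnorm foot - 2 * z.1 * foot.1 = (sqnorm z * G ^+ 2 +
      (Dl * z.1 + q * f) ^+ 2 + r ^+ 2 - 2 * z.1 * G * (Dl * z.1 + q * f)) /
      G ^+ 2.
    by rewrite /foot {2}/sqnorm /=; move: (G) G0 => g g0; field; rewrite gt_eqF.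
  have G1 : G ^+ 2 != 0 by rewrite gt_eqF// exprn_gt0.
  have GD1 : G * Dl != 0 by rewrite gt_eqF// mulr_gt0.
  apply/eqP; rewrite eqr_div //; apply/eqP.
  by rewrite r2 /G fE /Dl /line_disc /sqnorm; ring.
by rewrite /foot /=; move: (G) G0 => g g0; field; rewrite !gt_eqF.
Qed.

(** The difference of the squares of the two members is a square, up to a positive
    factor, once c is eliminated by means of the equation of the line. *)
Let cosh_line w : hline P Q w -> r / (Dl * z.2) <= cosh (hdist z w).
Proof.
move=> [w0 ew]; have w20 : 0 < w.2 by [].
rewrite cosh_hdistE//.
pose M := (z.1 - w.1) ^+ 2 + z.2 ^+ 2 + w.2 ^+ 2.
have -> : sqnorm z + sqnorm w - 2 * z.1 * w.1 = M by rewrite /M /sqnorm; ring.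
have M0 : 0 <= M by rewrite !addr_ge0 ?sqr_ge0.
have key : 0 <= Dl * M ^+ 2 - 4 * w.2 ^+ 2 * (Dl * z.2 ^+ 2 + f ^+ 2).
  have cE : c = q * w.1 - p * sqnorm w by have := sideE w; rewrite ew; lra.
  have fE : f = p * (z.1 ^+ 2 + z.2 ^+ 2) - q * z.1 + c by exact: sideE.
  have [p0|p0] := eqVneq p 0.
    set E := _ - _.
    have -> : E = (q * ((z.1 - w.1) ^+ 2 + z.2 ^+ 2 - w.2 ^+ 2)) ^+ 2.
      by rewrite /E /M fE /Dl /line_disc cE p0; ring.
    exact: sqr_ge0.
  rewrite -(@pmulr_rge0 _ (p ^+ 2)) ?exprn_even_gt0//.
  set E := _ * _.
  have -> : E = (f * (2 * p * w.1 - q) + Dl * (w.1 - z.1)) ^+ 2.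
    by rewrite /E /M fE /Dl /line_disc cE /sqnorm; ring.
  exact: sqr_ge0.
have : 2 * w.2 * r <= M * Dl.
  rewrite -(@ler_pXn2r _ 2) ?nnegrE ?mulr_ge0//; try exact: ltW.
  rewrite [_ ^+ 2](_ : _ = 4 * w.2 ^+ 2 * r ^+ 2); last by ring.
  rewrite r2 -subr_ge0; set E := _ - _.
  have -> : E = Dl * (Dl * M ^+ 2 - 4 * w.2 ^+ 2 * (Dl * z.2 ^+ 2 + f ^+ 2)).
    by rewrite /E; ring.
  by rewrite mulr_ge0// ltW.
move=> le_M; rewrite ler_pdivrMr ?mulr_gt0// mulrAC ler_pdivlMr ?mulr_gt0//.
rewrite -subr_ge0; set E := _ - _.
have -> : E = z.2 * (M * Dl - 2 * w.2 * r) by rewrite /E; ring.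
by rewrite mulr_ge0 ?subr_ge0// ltW.
Qed.

(** In other words, sinh of the distance is the modulus of side over the product
    of the height and the square root of the discriminant, so that the points at
    a given distance satisfy an equation that is linear in x, y, x^2 + y^2. *)
Lemma cosh_dist_to_line :
  cosh (dist_to_line P Q z) ^+ 2 = 1 + side P Q z ^+ 2 / (line_disc * z.2 ^+ 2).
Proof.
have -> : dist_to_line P Q z = hdist z foot.
  apply/eqP; rewrite eq_le; apply/andP; split.
    apply: ge_inf; last by exists foot; first exact: foot_line.
    by exists 0 => _ [w [w0 _] <-]; exact: hdist_ge0 z0 w0.
  apply: lb_le_inf; first by exists (hdist z foot), foot; first exact: foot_line.
  move=> _ [w hw <-]; have [w0 _] := hw; rewrite leNgt; apply/negP => lt_w.
  have := cosh_ltr (hdist_ge0 z0 w0) lt_w.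
  by rewrite ltNge cosh_foot (cosh_line hw).
rewrite cosh_foot expr_div_n r2 -/f -/Dl.
by field; rewrite !gt_eqF.
Qed.

End DistanceToLine.

(** This treats the three kinds of cycles uniformly: the distance to a point, or
    to a line, is a function of an affine form in (x, x^2 + y^2) divided by y. *)
Lemma cycle_section K : is_cycle K ->
  exists al be ga, forall z, K z -> z.2 = al + be * z.1 + ga * sqnorm z.
Proof.
case=> [ [ctr [r [ctr0 r0 ->]]]|[ [k k0 ->]|[p [k [k0 ->]]]]|[P [Q [h [P0 Q0 PQ h0 ->]]]]].
- pose m := 2 * ctr.2 * cosh r.
  have c20 : 0 < ctr.2 by [].
  have m0 : 0 < m by rewrite mulr_gt0 ?cosh_gt0// mulr_gt0.
  exists (sqnorm ctr / m), (- (2 * ctr.1) / m), m^-1 => z [z0 e].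
  have z20 : 0 < z.2 by [].
  apply: (mulfI (lt0r_neq0 m0)); rewrite {1}/m -e cosh_hdistE//.
  move: (m) m0 => m' m0.
  by field; rewrite !gt_eqF.
- by exists k, 0, 0 => z /= ->; ring.
- exists (p ^+ 2 / k), (- (2 * p) / k), k^-1 => z [z0 e].
  apply: (mulfI (lt0r_neq0 k0)); rewrite -e /sqnorm; field.
  by rewrite gt_eqF.
- have D0 := line_disc_gt0 P0 Q0 PQ.
  have s0 := sinh_gt0 h0.
  have q0 : 0 < Num.sqrt (line_disc P Q) by rewrite sqrtr_gt0.
  pose m := Num.sqrt (line_disc P Q) * sinh h.
  have m0 : 0 < m by rewrite mulr_gt0.
  exists ((- (Q.1 - P.1) * sqnorm P + (sqnorm Q - sqnorm P) * P.1) / m),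
    (- (sqnorm Q - sqnorm P) / m), ((Q.1 - P.1) / m) => z [z0 fz e].
  have z20 : 0 < z.2 by [].
  have : m * z.2 = side P Q z.
    apply: (@pexpIrn _ 2); rewrite ?nnegrE ?ltW//; first exact: mulr_gt0.
    have := cosh_dist_to_line P0 Q0 PQ z0; rewrite e cosh2_sinh2 => /addrI e2.
    have -> : (m * z.2) ^+ 2 =
        Num.sqrt (line_disc P Q) ^+ 2 * sinh h ^+ 2 * z.2 ^+ 2.
      by rewrite /m; ring.
    rewrite e2 sqr_sqrtr ?ltW//; field.
    by rewrite !gt_eqF.
  move=> e1; apply: (mulfI (lt0r_neq0 m0)); rewrite e1 /side.
  by move: (m) m0 => m' m0; field; rewrite gt_eqF.
Qed.

End CyclesAreSections.

(** * Integrals along vertical rays and geodesic arcs *)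

Section ArcIntegral.
Context {R : realType}.
Implicit Types (P Q z : R * R) (x y a : R).
Local Notation mu := (@lebesgue_measure R).

Lemma is_derive_continuous (F : R -> R) x d :
  is_derive x 1 F d -> {for x, continuous F}.
Proof.
move=> dF; apply: differentiable_continuous; apply/derivable1_diffP.
exact: ex_derive.
Qed.

Let is_derive_oppV y : y != 0 -> is_derive y 1 (fun u : R => - u^-1) (y ^- 2).
Proof.
move=> y0.
have h : is_derive y 1 (fun u : R => u^-1) (- y ^- 2 *: 1).
  exact: is_deriveV.
have := @is_deriveN _ _ _ _ _ _ _ h.
by rewrite -scaleNr opprK [_ *: _]mulr1.
Qed.

Lemma measurable_inv : measurable_fun setT (@GRing.inv R).
Proof.
have -> : [set: R] = ~` [set 0] `|` [set 0] by rewrite setvU.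
have o0 : open (~` [set (0 : R)]).
  by apply: closed_openC; exact: accessible_closed_set1 (@hausdorff_accessible _ (@Rhausdorff R)) 0.
apply/measurable_funU => //; first exact: open_measurable.
split; last exact: measurable_fun_set1.
apply: open_continuous_measurable_fun => // x; rewrite inE /= => x0.
by apply: inv_continuous; apply/eqP.
Qed.

Lemma measurable_inv_sqr : measurable_fun setT (fun y : R => y ^- 2).
Proof.
apply: (@measurableT_comp _ _ _ _ _ _ (@GRing.inv R) _ (fun y => y ^+ 2)).
  exact: measurable_inv.
exact: exprn_measurable.
Qed.

Lemma integral_vertical_ray (b : bool) a : 0 < a ->
  (\int[mu]_(y in [set` Interval (BSide b a) +oo%O]) (y ^- 2)%:E = (a^-1)%:E)%E.
Proof.
move=> a0.
have cont y : 0 < y -> {for y, continuous (fun u : R => u ^- 2)}.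
  move=> y0; apply: (@is_derive_continuous _ _ (- (y ^+ 2) ^- 2 *: (2%:R * y ^+ 1 *: 1))).
  apply: is_deriveV; first by rewrite gt_eqF// exprn_gt0.
  exact: (@is_deriveX _ _ id 2 y 1 1).
have cl : (\int[mu]_(y in `[a, +oo[) (y ^- 2)%:E = (a^-1)%:E)%E.
  rewrite (@ge0_continuous_FTC2y _ (fun y => y ^- 2) (fun y => - y^-1) a 0).
  - by rewrite sub0e -EFinN opprK.
  - by move=> y _; rewrite invr_ge0 sqr_ge0.
  - apply/continuous_within_itvcyP; split.
      by move=> y; rewrite in_itv/= andbT => ay; apply: cont; exact: lt_trans ay.
    by apply: cvg_at_right_filter; exact: cont.
  - rewrite -oppr0; apply: cvgN.
    apply/gtr0_cvgV0; last exact: cvg_id.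
    by near=> y.
  - move=> y ay; apply: (@ex_derive _ _ _ _ _ _ _ (is_derive_oppV _)).
    by rewrite gt_eqF// (lt_trans a0).
  - have a1 : a != 0 by rewrite gt_eqF.
    apply: cvg_at_right_filter.
    exact: (is_derive_continuous (is_derive_oppV a1)).
  - move=> y; rewrite in_itv/= andbT => ay; rewrite derive1E.
    apply: (@derive_val _ _ _ _ _ _ _ (is_derive_oppV _)).
    by rewrite gt_eqF// (lt_trans a0).
case: b => //; rewrite integral_itv_obnd_cbnd//.
apply/measurable_EFinP; apply: (@measurable_funS _ _ _ _ setT) => //.
exact: measurable_inv_sqr.
Unshelve. all: by end_near. Qed.

(** In the coordinates (x, x^2 + y^2) the line PQ is straight; this is y^2 on
    the chord PQ at abscissa x. *)
Definition height2 P Q x : R :=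
  sqnorm P + (sqnorm Q - sqnorm P) / (Q.1 - P.1) * (x - P.1) - x ^+ 2.

Definition height P Q x : R := Num.sqrt (height2 P Q x).

Section Arc.
Variables P Q : R * R.
Hypotheses (P0 : hplane P) (Q0 : hplane Q) (PQ : P.1 < Q.1).
Let m := (sqnorm Q - sqnorm P) / (Q.1 - P.1).

Let P20 : 0 < P.2. Proof. by []. Qed.
Let Q20 : 0 < Q.2. Proof. by []. Qed.
Let p0 : 0 < Q.1 - P.1. Proof. by rewrite subr_gt0. Qed.

Lemma height2_gt0 x : P.1 <= x <= Q.1 -> 0 < height2 P Q x.
Proof.
move=> /andP[Px xQ].
have -> : height2 P Q x = ((Q.1 - x) * P.2 ^+ 2 + (x - P.1) * Q.2 ^+ 2) /
    (Q.1 - P.1) + (x - P.1) * (Q.1 - x).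
  by rewrite /height2 /sqnorm; field; rewrite gt_eqF.
rewrite ltr_pwDl ?mulr_ge0 ?subr_ge0// divr_gt0//.
have := exprn_gt0 2 P20; have := exprn_gt0 2 Q20.
move: (Q.2 ^+ 2) (P.2 ^+ 2) => u v u0 v0.
have [->|xP] := eqVneq x P.1; first by rewrite subrr mul0r addr0 mulr_gt0.
rewrite ltr_wpDl ?mulr_gt0 ?mulr_ge0 ?subr_ge0 ?subr_gt0//; first exact: ltW.
by rewrite lt_neqAle eq_sym xP.
Qed.

Lemma height_right : height P Q Q.1 = Q.2.
Proof.
rewrite /height /height2 divfK ?gt_eqF// /sqnorm.
rewrite [X in Num.sqrt X](_ : _ = Q.2 ^+ 2); last by ring.
by rewrite sqrtr_sqr gtr0_norm.
Qed.

Lemma side_height x y : P.1 <= x <= Q.1 ->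
  side P Q (x, y) = (Q.1 - P.1) * (y ^+ 2 - height P Q x ^+ 2).
Proof.
move=> /height2_gt0/ltW h0; rewrite sqr_sqrtr// /height2 /side {1}/sqnorm /=.
by field; rewrite gt_eqF.
Qed.

Lemma is_derive_height x : P.1 <= x <= Q.1 ->
  is_derive x 1 (height P Q) ((m / 2 - x) / height P Q x).
Proof.
move=> /height2_gt0 h0.
have d2 : is_derive x 1 (height2 P Q) (m - 2 * x).
  have e : height2 P Q = cst (sqnorm P - m * P.1) + m \*: id - id ^+ 2.
    apply/funext => t; rewrite /height2 -/m !fctE; rewrite /= [_ *: _](_ : _ = m * t) //; ring.
  by rewrite e; apply: is_derive_eq; rewrite /GRing.scale /=; ring.
have ds := is_derive1_sqrt h0.
have := is_derive1_comp ds d2.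
have s0 : 0 < height P Q x by rewrite sqrtr_gt0.
move=> dc; apply: is_derive_eq; move: s0; rewrite /height => s0.
by field; rewrite gt_eqF.
Qed.

(** The angle under which the arc from P to the point of abscissa x is seen from
    the centre of the circle, by the tangent of the inscribed angle. *)
Definition arc_angle x : R := 2 * atan ((x - P.1) / (P.2 + height P Q x)).

Lemma is_derive_arc_angle x : P.1 <= x <= Q.1 ->
  is_derive x 1 arc_angle (height P Q x)^-1.
Proof.
move=> xPQ; have dh := is_derive_height xPQ; have h0 := height2_gt0 xPQ.
have s0 : 0 < height P Q x by rewrite sqrtr_gt0.
have D0 : 0 < P.2 + height P Q x by rewrite addr_gt0.
have dD : is_derive x 1 (cst P.2 + height P Q) ((m / 2 - x) / height P Q x).
  by apply: is_derive_eq; rewrite add0r.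
have dV := @is_deriveV _ (cst P.2 + height P Q) x _ 1 (lt0r_neq0 D0) dD.
have e : arc_angle = 2 \*: (atan \o ((id - cst P.1) *
    (fun y => ((cst P.2 + height P Q) y)^-1))).
  by apply/funext => t; rewrite /arc_angle !fctE.
rewrite e; apply: is_derive_eq.
rewrite /GRing.scale /= !fctE /=.
have : height P Q x ^+ 2 = height2 P Q x by rewrite sqr_sqrtr// ltW.
rewrite /height2 -/m /sqnorm.
move: (height P Q x) s0 D0 => h s0 D0 hE.
have k0 : 0 < (P.2 + h) ^+ 2 + (x - P.1) ^+ 2.
  by rewrite ltr_pwDl ?sqr_ge0// exprn_gt0.
transitivity ((2 * h * (P.2 + h) - m * (x - P.1) + 2 * x * (x - P.1)) /
    (h * ((P.2 + h) ^+ 2 + (x - P.1) ^+ 2))).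
  by field; rewrite !gt_eqF//= (ltr_pwDl (exprn_gt0 2 D0) (sqr_ge0 _)).
have -> : m * (x - P.1) = h ^+ 2 - P.1 ^+ 2 - P.2 ^+ 2 + x ^+ 2 by rewrite hE; ring.
rewrite (_ : _ - _ + _ = (P.2 + h) ^+ 2 + (x - P.1) ^+ 2); last by ring.
by rewrite invfM mulrCA divff ?mulr1// gt_eqF.
Qed.

Lemma continuous_inv_height x : P.1 <= x <= Q.1 ->
  {for x, continuous (fun x => (height P Q x)^-1)}.
Proof.
move=> xPQ; apply: is_derive_continuous.
apply: is_deriveV; last exact: is_derive_height.
by rewrite gt_eqF// sqrtr_gt0 height2_gt0.
Qed.

(** On a circle of centre c on the axis y = 0, dx / y is the differential of the
    angle at c. *)
Lemma integral_arc :
  (\int[mu]_(x in `[P.1, Q.1]) ((height P Q x)^-1)%:E =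
   (2 * atan ((Q.1 - P.1) / (P.2 + Q.2)))%:E)%E.
Proof.
have inI x : x \in `]P.1, Q.1[ -> P.1 <= x <= Q.1.
  by rewrite in_itv/= => /andP[/ltW -> /ltW ->].
have Pin : P.1 <= P.1 <= Q.1 by rewrite lexx ltW.
have Qin : P.1 <= Q.1 <= Q.1 by rewrite lexx ltW.
have cA x : P.1 <= x <= Q.1 -> {for x, continuous arc_angle}.
  by move=> xPQ; exact: is_derive_continuous (is_derive_arc_angle xPQ).
rewrite (@continuous_FTC2 _ _ arc_angle _ _ PQ).
- by rewrite /arc_angle height_right subrr mul0r atan0 mulr0 sube0.
- apply/continuous_within_itvP => //; split.
  + by move=> x /inI; exact: continuous_inv_height.
  + by apply: cvg_at_right_filter; exact: continuous_inv_height.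
  + by apply: cvg_at_left_filter; exact: continuous_inv_height.
- split.
  + by move=> x /inI xPQ; exact: (@ex_derive _ _ _ _ _ _ _ (is_derive_arc_angle xPQ)).
  + by apply: cvg_at_right_filter; exact: cA.
  + by apply: cvg_at_left_filter; exact: cA.
- move=> x /inI xPQ; rewrite derive1E.
  exact: (@derive_val _ _ _ _ _ _ _ (is_derive_arc_angle xPQ)).
Qed.

End Arc.
End ArcIntegral.

(** * Ray casting in a convex quadrilateral *)

Section RayCasting.
Context {R : realType}.
Implicit Types (A B C D P Q z : R * R).

(** The signed number of times that the downward vertical ray from z meets the
    side PQ.  The ray is closed at z when PQ goes to the right and open when PQ
    goes to the left, because the vertical sections of a polygon are closed
    intervals; the sums below are then exact even when z lies on a side. *)
Definition cross P Q z : R :=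
  ((P.1 < z.1 < Q.1) && (0 <= side P Q z))%:R -
  ((Q.1 < z.1 < P.1) && (side P Q z < 0))%:R.

(** The signs of the barycentric coordinates of z and of the horizontal
    displacements from z to the vertices determine everything; the two linear
    relations exclude the sign patterns for which the formula fails. *)
Let cross_sign (la lb lc xa xb xc : R) :
  0 < la + lb + lc -> la * xa + lb * xb + lc * xc = 0 ->
  xa != 0 -> xb != 0 -> xc != 0 ->
  ((xa < 0) && (0 < xb) && (0 <= lc))%:R - ((xb < 0) && (0 < xa) && (lc < 0))%:R +
  (((xb < 0) && (0 < xc) && (0 <= la))%:R - ((xc < 0) && (0 < xb) && (la < 0))%:R) +
  (((xc < 0) && (0 < xa) && (0 <= lb))%:R - ((xa < 0) && (0 < xc) && (lb < 0))%:R)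
  = [&& 0 <= lc, 0 <= la & 0 <= lb]%:R :> R.
Proof.
move=> s0 e0.
case: (ltgtP xa 0) => // xa0 _; case: (ltgtP xb 0) => // xb0 _;
case: (ltgtP xc 0) => // xc0 _ /=;
case: (ltgtP la 0) => la0 /=; case: (ltgtP lb 0) => lb0 /=;
case: (ltgtP lc 0) => lc0 /=;
rewrite ?(subr0, sub0r, add0r, addr0, subrr, addrK, addNr) //; exfalso; nra.
Qed.

Lemma cross_triangle A B C z : 0 < side A B C ->
  z.1 != A.1 -> z.1 != B.1 -> z.1 != C.1 ->
  cross A B z + cross B C z + cross C A z =
  [&& 0 <= side A B z, 0 <= side B C z & 0 <= side C A z]%:R.
Proof.
move=> s0 zA zB zC.
have h1 : 0 < side B C z + side C A z + side A B z.
  by rewrite (_ : _ + _ = side A B C)//; rewrite /side /sqnorm; ring.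
have h2 : side B C z * (A.1 - z.1) + side C A z * (B.1 - z.1) +
    side A B z * (C.1 - z.1) = 0 by rewrite /side /sqnorm; ring.
have := cross_sign h1 h2; rewrite !subr_eq0 ![_ == z.1]eq_sym => /(_ zA zB zC).
by rewrite /cross !subr_lt0 !subr_gt0.
Qed.

Let side_diag A C z : side C A z = - side A C z.
Proof. exact: sideN. Qed.

(** On the line AC the third barycentric coordinate vanishes, and being in the
    triangle means being between A and C. *)
Let diag_sign (la lc xa xc : R) : 0 < la + lc -> la * xa + lc * xc = 0 ->
  xa != 0 -> xc != 0 ->
  (0 <= lc) && (0 <= la) = ((xa < 0) && (0 < xc)) || ((xc < 0) && (0 < xa)).
Proof.
move=> s0 e0.
case: (ltgtP xa 0) => // xa0 _; case: (ltgtP xc 0) => // xc0 _ /=;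
case: (ltgtP la 0) => la0 /=; case: (ltgtP lc 0) => lc0 //=; exfalso; nra.
Qed.

(** A point of the triangle ABC is a convex combination of vertices that lie on
    the nonnegative side of CD and of DA. *)
Let half_convex A B C D z : 0 < side A B C ->
  0 <= side C D A -> 0 <= side C D B -> 0 <= side D A B -> 0 <= side D A C ->
  0 <= side A B z -> 0 <= side B C z -> 0 <= side C A z ->
  (0 <= side C D z) && (0 <= side D A z).
Proof.
move=> s0 cda cdb dab dac ab bc ca; apply/andP; split;
  rewrite -(pmulr_rge0 _ s0).
- have -> : side A B C * side C D z =
      side B C z * side C D A + side C A z * side C D B.
    by rewrite /side /sqnorm; ring.
  by rewrite addr_ge0// mulr_ge0.
- have -> : side A B C * side D A z =
      side C A z * side D A B + side A B z * side D A C.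
    by rewrite /side /sqnorm; ring.
  by rewrite addr_ge0// mulr_ge0.
Qed.

(** The diagonal AC cuts the quadrilateral into two triangles.  It is crossed in
    both directions, and the two crossings cancel except when z lies on it; then
    z belongs to both triangles, and what remains is its second count. *)
Lemma cross_quadrilateral A B C D z :
  0 < side A B C -> 0 < side B C D -> 0 < side C D A -> 0 < side D A B ->
  z.1 != A.1 -> z.1 != B.1 -> z.1 != C.1 -> z.1 != D.1 ->
  cross A B z + cross B C z + cross C D z + cross D A z =
  [&& 0 <= side A B z, 0 <= side B C z, 0 <= side C D z & 0 <= side D A z]%:R.
Proof.
move=> abc bcd cda dab zA zB zC zD.
have t1 := cross_triangle abc zA zB zC.
have t2 := cross_triangle cda zC zD zA.
have dac : 0 < side D A C by rewrite -side_cycle.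
have cdb : 0 < side C D B by rewrite -side_cycle.
have bca : 0 < side B C A by rewrite -side_cycle.
have abd : 0 < side A B D by rewrite -side_cycle.
have h1 := @half_convex A B C D z abc (ltW cda) (ltW cdb) (ltW dab) (ltW dac).
have h2 := @half_convex C D A B z cda (ltW abc) (ltW abd) (ltW bcd) (ltW bca).
have d1 := @diag_sign (side B C z) (side A B z) (A.1 - z.1) (C.1 - z.1).
have d2 := @diag_sign (side D A z) (side C D z) (C.1 - z.1) (A.1 - z.1).
rewrite !subr_eq0 !subr_lt0 !subr_gt0 ![_ == z.1]eq_sym in d1 d2.
have s1 : side B C z + side C A z + side A B z = side A B C.
  by rewrite /side /sqnorm; ring.
have s2 : side D A z + side A C z + side C D z = side C D A.
  by rewrite /side /sqnorm; ring.
have m1 : side B C z * (A.1 - z.1) + side C A z * (B.1 - z.1) +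
    side A B z * (C.1 - z.1) = 0 by rewrite /side /sqnorm; ring.
have m2 : side D A z * (C.1 - z.1) + side A C z * (D.1 - z.1) +
    side C D z * (A.1 - z.1) = 0 by rewrite /side /sqnorm; ring.
have -> : cross A B z + cross B C z + cross C D z + cross D A z =
    (cross A B z + cross B C z + cross C A z) +
    (cross C D z + cross D A z + cross A C z) - (cross A C z + cross C A z).
  by ring.
rewrite t1 t2 /cross (side_diag A C) oppr_ge0 oppr_lt0.
rewrite (side_diag A C) in h1 s1 m1.
case: (ltgtP (side A C z) 0) => s0 in h1 h2 *.
- rewrite !andbF !andbT /= addr0 !subr0 sub0r addNr subr0.
  move: h1; rewrite oppr_ge0 (ltW s0).
  case: (0 <= side A B z) => //=; case: (0 <= side B C z) => //=.
  by move=> /(_ isT isT isT) ->.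
- rewrite !andbF !andbT /= add0r !subr0 sub0r subrr subr0.
  move: h2; case: (0 <= side C D z); last by rewrite !andbF.
  case: (0 <= side D A z); last by rewrite !andbF.
  by move=> /(_ isT isT isT) /andP[-> ->].
- rewrite s0 in s1 s2 m1 m2.
  have {}d1 : (0 <= side A B z) && (0 <= side B C z) =
      (A.1 < z.1 < C.1) || (C.1 < z.1 < A.1).
    by apply: d1 => //; [move: abc; rewrite -s1; lra | move: m1; lra].
  have {}d2 : (0 <= side C D z) && (0 <= side D A z) =
      (C.1 < z.1 < A.1) || (A.1 < z.1 < C.1).
    by apply: d2 => //; [move: cda; rewrite -s2; lra | move: m2; lra].
  rewrite !andbT !andbF /= !subr0 [in RHS]andbA d1 d2.
  case: (ltgtP A.1 z.1) zA => // _ _; case: (ltgtP C.1 z.1) zC => // _ _ /=;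
    ring.
Qed.

End RayCasting.

(** * The area by Fubini's theorem *)

Section AreaByFubini.
Context {R : realType}.
Implicit Types (A B C D P Q z : R * R).
Local Notation mu := (@lebesgue_measure R).
Local Notation mu2 := (mu \x mu)%E.

(** The part of the half-plane above the arc PQ and between the verticals of its
    ends, with or without the arc. *)
Definition above (c : bool) P Q z : bool :=
  [&& 0 < z.2, P.1 < z.1 < Q.1 &
      if c then 0 <= side P Q z else 0 < side P Q z].

Let measurable_side P Q : measurable_fun setT (side P Q : R * R -> R).
Proof.
apply: measurable_funB.
  apply: measurable_funM => //; apply: measurable_funB => //.
  by apply: measurable_funD; apply: measurable_funX;
    [exact: measurable_fst|exact: measurable_snd].
by apply: measurable_funM => //; apply: measurable_funB.
Qed.

Definition restrict_density (b : R * R -> bool) z : R :=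
  if b z then z.2 ^- 2 else 0.

Lemma measurable_restrict_density b : measurable_fun setT b ->
  measurable_fun setT (restrict_density b).
Proof.
move=> mb; apply: measurable_fun_ifT => //.
apply: (@measurableT_comp _ _ _ _ _ _ (fun y : R => y ^- 2) _ snd).
  exact: measurable_inv_sqr.
exact: measurable_snd.
Qed.

Lemma restrict_density_ge0 b z : 0 <= restrict_density b z.
Proof. by rewrite /restrict_density; case: ifP; rewrite // invr_ge0 sqr_ge0. Qed.

Lemma measurable_above c P Q : measurable_fun setT (above c P Q).
Proof.
have m1 := @measurable_fst _ _ (measurableTypeR R) (measurableTypeR R).
have m2 := @measurable_snd _ _ (measurableTypeR R) (measurableTypeR R).
apply: measurable_and; first exact: measurable_fun_ltr.
apply: measurable_and.
  by apply: measurable_and; exact: measurable_fun_ltr.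
by case: c; [apply: measurable_fun_ler|apply: measurable_fun_ltr].
Qed.

Section Above.
Variables (c : bool) (P Q : R * R).
Hypotheses (P0 : hplane P) (Q0 : hplane Q) (PQ : P.1 < Q.1).

(** Each vertical ray above the arc contributes the inverse of the height at
    which it starts, and these inverses integrate to the angle of the arc. *)
Lemma integral_above :
  (\int[mu2]_z (restrict_density (above c P Q) z)%:E =
   (2 * atan ((Q.1 - P.1) / (P.2 + Q.2)))%:E)%E.
Proof.
rewrite fubini_tonelli1/=; last 2 first.
- apply/measurable_EFinP; apply: measurable_restrict_density; apply: measurable_above.
- by move=> z; rewrite lee_fin restrict_density_ge0.
rewrite -integral_arc//.
transitivity (\int[mu]_(x in `]P.1, Q.1[) ((height P Q x)^-1)%:E)%E; last first.
  rewrite -(@integral_itv_bndoo _ P.1 Q.1 _ true false)//.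
  apply/measurable_EFinP; apply: open_continuous_measurable_fun.
    exact: interval_open.
  move=> x; rewrite inE/= in_itv/= => /andP[/ltW Px /ltW xQ].
  by apply: (continuous_inv_height P0 Q0 PQ); rewrite Px.
rewrite [RHS]integral_mkcond; apply: eq_integral => x _.
rewrite /fubini_F patchE; case: ifPn.
  rewrite inE/= in_itv/= => /andP[Px xQ].
  have xPQ : P.1 <= x <= Q.1 by rewrite !ltW.
  have h0 : 0 < height P Q x by rewrite sqrtr_gt0 height2_gt0.
  rewrite -(integral_vertical_ray c h0) [RHS]integral_mkcond.
  apply: eq_integral => y _; rewrite patchE /restrict_density /above /=.
  rewrite Px xQ side_height// mem_setE (fun_if EFin) -[point]/(0%:E) /=.
  have p0 : 0 < Q.1 - P.1 by rewrite subr_gt0.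
  move: (height P Q x) h0 => h h0.
  have [y0|y0] := ltP 0 y; last first.
    rewrite /=; case: ifP => // hy; exfalso.
    have : h <= y by case: (c) hy; rewrite in_itv/= andbT// => /ltW.
    by move=> /(lt_le_trans h0); rewrite ltNge y0.
  have [h1 y1] := (ltW h0, ltW y0).
  case: c => /=; rewrite in_itv/= andbT.
    by rewrite pmulr_rge0// subr_ge0 ler_pXn2r ?nnegrE.
  by rewrite pmulr_rgt0// subr_gt0 ltr_pXn2r ?nnegrE.
rewrite mem_setE in_itv/= => xPQ.
apply: integral0_eq => y _.
by rewrite /restrict_density /above /= (negbTE xPQ) andbF.
Qed.

End Above.

(** The density of the area, counted with the multiplicity of the crossing. *)
Definition sweep P Q z : R := restrict_density (fun z => 0 < z.2) z * cross P Q z.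

Lemma sweep_right P Q : P.1 < Q.1 -> sweep P Q = restrict_density (above true P Q).
Proof.
move=> PQ; apply/funext => z; rewrite /sweep /cross /restrict_density /above.
have -> : Q.1 < z.1 < P.1 = false.
  by apply/negbTE/negP => /andP[h1 h2]; have := lt_trans h1 (lt_trans h2 PQ); rewrite ltxx.
rewrite subr0; case: (0 < z.2); last by rewrite mul0r.
by case: (_ && _); rewrite ?mulr1 ?mulr0.
Qed.

Lemma sweep_left P Q : Q.1 < P.1 ->
  sweep P Q = \- restrict_density (above false Q P).
Proof.
move=> QP; apply/funext => z; rewrite /sweep /cross /= /restrict_density /above.
have -> : P.1 < z.1 < Q.1 = false.
  by apply/negbTE/negP => /andP[h1 h2]; have := lt_trans h1 (lt_trans h2 QP); rewrite ltxx.
rewrite sub0r (sideN P Q) oppr_gt0 /=; case: (0 < z.2); last by rewrite mul0r oppr0.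
by case: (_ && _); rewrite ?mulrN ?mulr1 ?mulr0.
Qed.

Lemma sweep_vertical P Q : P.1 = Q.1 -> sweep P Q = cst 0.
Proof.
move=> e; apply/funext => z; rewrite /sweep /cross -e.
have -> : P.1 < z.1 < P.1 = false.
  by apply/negbTE/negP => /andP[h1 h2]; have := lt_trans h1 h2; rewrite ltxx.
by rewrite subrr mulr0.
Qed.

Let integrable_above c P Q : hplane P -> hplane Q -> P.1 < Q.1 ->
  mu2.-integrable setT (EFin \o restrict_density (above c P Q)).
Proof.
move=> P0 Q0 PQ; apply/integrableP; split.
  apply/measurable_EFinP; apply: measurable_restrict_density; apply: measurable_above.
under eq_integral do rewrite /= ger0_norm ?restrict_density_ge0//.
by rewrite integral_above// ltry.
Qed.

Lemma integrable_sweep P Q : hplane P -> hplane Q ->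
  mu2.-integrable setT (EFin \o sweep P Q).
Proof.
move=> P0 Q0; have [PQ|QP|e] := ltgtP P.1 Q.1.
- by rewrite sweep_right//; exact: integrable_above.
- rewrite sweep_left//.
  by have := integrableN (integrable_above false Q0 P0 QP).
- by rewrite sweep_vertical//; exact: integrable0.
Qed.

Lemma integral_sweep P Q : hplane P -> hplane Q ->
  \int[mu2]_z sweep P Q z = 2 * atan ((Q.1 - P.1) / (P.2 + Q.2)).
Proof.
move=> P0 Q0; have [PQ|QP|e] := ltgtP P.1 Q.1.
- by rewrite sweep_right// /Rintegral integral_above.
- rewrite sweep_left// /Rintegral.
  under eq_integral do rewrite /= EFinN.
  rewrite integralN/=; last first.
    exact: integrable_add_def (integrable_above false Q0 P0 QP).
  rewrite integral_above//= -mulrN -atanN; congr (2 * atan _).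
  by rewrite -mulNr opprB addrC [Q.2 + _]addrC.
- rewrite sweep_vertical// /Rintegral integral0/= e subrr mul0r atan0 mulr0//.
Qed.

Let ae_fst (x : R) : {ae mu2, forall z, z.1 != x}.
Proof.
exists ([set x] `*` setT); split.
- exact: measurableX.
- rewrite product_measure1E//= -[X in (X * _)%E]/(mu [set x]).
  by rewrite lebesgue_measure_set1 mul0e.
- by move=> z /= /negP; rewrite negbK => /eqP ->.
Qed.

(** The density of the quadrilateral is almost everywhere the sum of the sweeps
    of its sides, as [cross_quadrilateral] only leaves out the verticals of the
    vertices. *)
Lemma harea_positive A B C D :
  hplane A -> hplane B -> hplane C -> hplane D ->
  0 < side A B C -> 0 < side B C D -> 0 < side C D A -> 0 < side D A B ->
  harea [set z | hplane z /\ [/\ 0 <= side A B z, 0 <= side B C z,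
                                 0 <= side C D z & 0 <= side D A z]] =
  2 * (atan ((B.1 - A.1) / (A.2 + B.2)) + atan ((C.1 - B.1) / (B.2 + C.2)) +
       atan ((D.1 - C.1) / (C.2 + D.2)) + atan ((A.1 - D.1) / (D.2 + A.2))).
Proof.
move=> A0 B0 C0 D0 abc bcd cda dab.
pose inK z := [&& 0 <= side A B z, 0 <= side B C z, 0 <= side C D z &
  0 <= side D A z].
rewrite /harea Rintegral_mkcond !mulrDr -!integral_sweep//.
have iS := integrable_sweep.
have iAB := iS _ _ A0 B0; have iBC := iS _ _ B0 C0.
have iCD := iS _ _ C0 D0; have iDA := iS _ _ D0 A0.
rewrite -RintegralD//.
have iABC := integrableD measurableT iAB iBC.
rewrite -RintegralD//.
have iABCD := integrableD measurableT iABC iCD.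
rewrite -RintegralD//.
have iS4 := integrableD measurableT iABCD iDA.
have -> : (fun z => z.2 ^- 2) \_ [set z | hplane z /\ [/\ 0 <= side A B z,
      0 <= side B C z, 0 <= side C D z & 0 <= side D A z]] =
    restrict_density (fun z => (0 < z.2) && inK z).
  apply/funext => z; rewrite patchE /restrict_density; congr (if _ then _ else _).
  apply/idP/idP; rewrite inE /=; first by move=> [z0 [? ? ? ?]]; apply/and5P.
  by move=> /and5P[].
congr fine; apply: ae_eq_integral => //.
- apply/measurable_EFinP; apply: measurable_restrict_density.
  apply: measurable_and; first by apply: measurable_fun_ltr => //; exact: measurable_snd.
  by do 3 (apply: measurable_and; first by apply: measurable_fun_ler => //; exact: measurable_side);
    apply: measurable_fun_ler => //; exact: measurable_side.
- exact: measurable_int iS4.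
- have F : Filter (almost_everywhere mu2) by exact: ae_filter_ringOfSetsType.
  have hN := @filterI _ _ F _ _ (@filterI _ _ F _ _ (ae_fst A.1) (ae_fst B.1))
    (@filterI _ _ F _ _ (ae_fst C.1) (ae_fst D.1)).
  apply: (@filterS _ _ F _ _ _ hN).
  move=> z [[zA zB] [zC zD]] _; congr (_%:E).
  rewrite /sweep -!mulrDr cross_quadrilateral// /restrict_density -/(inK z).
  by case: (0 < z.2); rewrite ?mul0r//=; case: (inK z); rewrite ?mulr1 ?mulr0.
Qed.

End AreaByFubini.

(** * The half-area of a cyclic quadrilateral *)

Section QuadrilateralArea.
Context {R : realType}.
Implicit Types (A B C D P Q z u : R * R).

Lemma cos_atan_div u : 0 < u.1 ->
  cos (atan (u.2 / u.1)) * Num.sqrt (sqnorm u) = u.1.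
Proof.
move=> u0.
have e : 1 + (u.2 / u.1) ^+ 2 = sqnorm u / u.1 ^+ 2.
  by rewrite /sqnorm; field; rewrite gt_eqF.
have n0 : 0 < sqnorm u by rewrite /sqnorm ltr_pwDl ?sqr_ge0// exprn_gt0.
rewrite cos_atan e sqrtrM ?ltW// sqrtrV ?sqr_ge0// sqrtr_sqr gtr0_norm//.
have r0 : 0 < Num.sqrt (sqnorm u) by rewrite sqrtr_gt0.
by move: (Num.sqrt _) r0 => r r0; field; rewrite !gt_eqF.
Qed.

Lemma sin_atan_div u : 0 < u.1 ->
  sin (atan (u.2 / u.1)) * Num.sqrt (sqnorm u) = u.2.
Proof.
move=> u0; have := cos_atan_div u0; have := atanK (u.2 / u.1).
rewrite /tan; set t := atan _; set r := Num.sqrt _ => e ct.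
have c0 : cos t != 0.
  by apply/eqP => c0; move: u0; rewrite -ct c0 mul0r ltxx.
have -> : sin t = u.2 / u.1 * cos t by rewrite -e divfK.
by rewrite -mulrA ct divfK// gt_eqF.
Qed.

Definition turn_angle P Q : R := atan ((turn P Q).2 / (turn P Q).1).
Definition turn_norm P Q : R := Num.sqrt (sqnorm (turn P Q)).

Lemma turn_polar P Q : hplane P -> hplane Q ->
  turn P Q = (cos (turn_angle P Q) * turn_norm P Q,
              sin (turn_angle P Q) * turn_norm P Q).
Proof.
move=> P0 Q0; have t0 : 0 < (turn P Q).1 by exact: addr_gt0.
by rewrite /turn_angle /turn_norm cos_atan_div// sin_atan_div.
Qed.

Lemma sqnorm_turnE P Q : sqnorm (turn P Q) = turn_norm P Q ^+ 2.
Proof. by rewrite sqr_sqrtr// sqnorm_ge0. Qed.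

Lemma turn_angleN P Q : turn_angle Q P = - turn_angle P Q.
Proof.
rewrite /turn_angle /turn /= -atanN; congr atan.
by rewrite -mulNr opprB [Q.2 + _]addrC.
Qed.

(** The argument of a product is the sum of the arguments. *)
Lemma cos_turns A B C D : hplane A -> hplane B -> hplane C -> hplane D ->
  cos (turn_angle A B + turn_angle B C + turn_angle C D + turn_angle D A) ^+ 2
    * (sqnorm (turn A B) * sqnorm (turn B C) * sqnorm (turn C D) *
       sqnorm (turn D A)) =
  (holonomy A B C D).1 ^+ 2.
Proof.
move=> A0 B0 C0 D0.
rewrite /holonomy !sqnorm_turnE (turn_polar A0 B0) (turn_polar B0 C0).
rewrite (turn_polar C0 D0) (turn_polar D0 A0) /cmul /= !(cosD, sinD).
ring.
Qed.

Lemma sqnorm_turn P Q : hplane P -> hplane Q ->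
  sqnorm (turn P Q) = 4 * P.2 * Q.2 * cosh (hdist P Q / 2) ^+ 2.
Proof.
move=> P0 Q0; rewrite cosh2_sinh2 sinh_half_hdist//.
have P20 : 0 < P.2 by []. have Q20 : 0 < Q.2 by [].
by rewrite /turn /sqnorm /=; field; rewrite !gt_eqF.
Qed.

Lemma sqnorm_chord P Q : hplane P -> hplane Q ->
  sqnorm (P - Q) = 4 * P.2 * Q.2 * sinh (hdist P Q / 2) ^+ 2.
Proof.
move=> P0 Q0; rewrite sinh_half_hdist//.
have P20 : 0 < P.2 by []. have Q20 : 0 < Q.2 by [].
by field; rewrite !gt_eqF.
Qed.

Lemma convex_positive A B C D : convex_quadrilateral A B C D ->
  0 < side A B C ->
  [/\ 0 < side A B D, 0 < side B C D, 0 < side C D A & 0 < side D A B].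
Proof.
move=> [_ [h1 h2 h3 h4]] abc.
have abd : 0 < side A B D by rewrite -(pmulr_rgt0 _ abc).
have dab : 0 < side D A B by rewrite side_cycle.
have cda : 0 < side C D A by rewrite side_cycle -(pmulr_rgt0 _ dab).
have bcd : 0 < side B C D by rewrite side_cycle -(pmulr_rgt0 _ cda).
by [].
Qed.

Lemma quadrilateral_positive A B C D : convex_quadrilateral A B C D ->
  0 < side A B C ->
  quadrilateral A B C D =
    [set z | hplane z /\ [/\ 0 <= side A B z, 0 <= side B C z,
                             0 <= side C D z & 0 <= side D A z]].
Proof.
move=> hQ abc; have [abd bcd cda dab] := convex_positive hQ abc.
rewrite /quadrilateral /half_plane; apply/seteqP; split => z /=.
  move=> [[[[z0]]]]; rewrite !pmulr_lge0// => ? [_ ?] [_ ?] [_ ?].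
  by split.
by move=> [z0 [? ? ? ?]]; rewrite !pmulr_lge0.
Qed.

Lemma convex_rev A B C D :
  convex_quadrilateral A B C D -> convex_quadrilateral A D C B.
Proof.
move=> [[A0 B0 C0 D0] [h1 h2 h3 h4]]; split; split => //.
- by rewrite !(sideN D A) mulrNN mulrC.
- by rewrite !(sideN C D) mulrNN mulrC.
- by rewrite !(sideN B C) mulrNN mulrC.
- by rewrite !(sideN A B) mulrNN mulrC.
Qed.

Lemma quadrilateral_rev A B C D : convex_quadrilateral A B C D ->
  quadrilateral A D C B = quadrilateral A B C D.
Proof.
move=> hQ; have [_ [h1 h2 h3 h4]] := hQ.
have flip P Q V W z : 0 < side P Q W * side P Q V ->
    (0 <= side Q P z * side Q P V) = (0 <= side P Q z * side P Q W).
  rewrite mulrC => h; rewrite !(sideN P Q) mulrNN.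
  have [v0|v0|v0] := ltgtP 0 (side P Q V); last by move: h; rewrite -v0 mul0r ltxx.
    have w0 : 0 < side P Q W by rewrite -(pmulr_rgt0 _ v0).
    by rewrite !pmulr_lge0.
  have w0 : side P Q W < 0 by rewrite -(nmulr_rgt0 _ v0).
  by rewrite !nmulr_lge0.
rewrite /quadrilateral /half_plane; apply/seteqP; split => z /=;
  rewrite (flip _ _ _ _ _ h1) (flip _ _ _ _ _ h2) (flip _ _ _ _ _ h3)
    (flip _ _ _ _ _ h4);
  by move=> [[[[? ?] [? ?]] [? ?]] [? ?]].
Qed.

(** Half the area is the sum of the turn angles for a positively oriented
    quadrilateral, and its opposite otherwise; the cosine does not see the
    difference. *)
Lemma cos_half_area A B C D : convex_quadrilateral A B C D ->
  cos (harea (quadrilateral A B C D) / 2) =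
  cos (turn_angle A B + turn_angle B C + turn_angle C D + turn_angle D A).
Proof.
have pos E F G H : convex_quadrilateral E F G H -> 0 < side E F G ->
    harea (quadrilateral E F G H) / 2 =
    turn_angle E F + turn_angle F G + turn_angle G H + turn_angle H E.
  move=> hQ efg; have [efh fgh ghe hef] := convex_positive hQ efg.
  rewrite (quadrilateral_positive hQ efg).
  have [[E0 F0 G0 H0] _] := hQ.
  by rewrite harea_positive// mulrC mulKf.
move=> hQ; have [abc|abc|abc] := ltgtP 0 (side A B C).
- by rewrite (pos _ _ _ _ hQ abc).
- rewrite -(quadrilateral_rev hQ) (pos _ _ _ _ (convex_rev hQ)).
    rewrite (turn_angleN D A) (turn_angleN C D) (turn_angleN B C) (turn_angleN A B).
    by rewrite -cosN; congr cos; ring.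
  have [_ [_ _ h3 h4]] := hQ; have [_ [h1 _ _ _]] := hQ.
  have abd : side A B D < 0 by rewrite -(nmulr_rgt0 _ abc).
  have dab : side D A B < 0 by rewrite side_cycle.
  have dac : side D A C < 0 by rewrite -(nmulr_rgt0 _ dab).
  by rewrite side_cycle sideN oppr_gt0 side_cycle.
- by have [_ [+ _ _ _]] := hQ; rewrite -abc mul0r ltxx.
Qed.

(** Since the product of chords is a negative real number, it is minus its
    modulus. *)
Lemma re_chords_sinh A B C D :
  hplane A -> hplane B -> hplane C -> hplane D ->
  (chords A B C D).2 = 0 -> (chords A B C D).1 < 0 ->
  (chords A B C D).1 = - (16 * A.2 * B.2 * C.2 * D.2 *
    (sinh (hdist A B / 2) * sinh (hdist B C / 2) *
     sinh (hdist C D / 2) * sinh (hdist D A / 2))).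
Proof.
move=> A0 B0 C0 D0 im0 re0.
have : (chords A B C D).1 ^+ 2 = sqnorm (chords A B C D).
  by rewrite /sqnorm im0 expr0n addr0.
rewrite {2}/chords !sqnorm_cmul !sqnorm_cconj !sqnorm_chord//.
have M0 : 0 < 16 * A.2 * B.2 * C.2 * D.2 by rewrite !mulr_gt0.
move: (sinh_half_hdist_ge0 A0 B0) (sinh_half_hdist_ge0 B0 C0).
move: (sinh_half_hdist_ge0 C0 D0) (sinh_half_hdist_ge0 D0 A0).
move: (sinh _) (sinh _) (sinh _) (sinh _) => Sd Sc Sb Sa d0 c0 b0 a0 e.
apply/eqP; rewrite -eqr_oppLR; apply/eqP; apply: (@pexpIrn _ 2) => //.
- by rewrite nnegrE oppr_ge0 ltW.
- by rewrite nnegrE (mulr_ge0 (ltW M0))// !mulr_ge0.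
by rewrite sqrrN e; ring.
Qed.

(** The holonomy has real part 16 yA yB yC yD times the numerator below, and
    modulus 16 yA yB yC yD times the product of the cosh (a / 2). *)
Lemma cos_half_area_cyclic A B C D : cyclic_quadrilateral A B C D ->
  let Sa := sinh (hdist A B / 2) in let Sb := sinh (hdist B C / 2) in
  let Sc := sinh (hdist C D / 2) in let Sd := sinh (hdist D A / 2) in
  cos (harea (quadrilateral A B C D) / 2) ^+ 2 =
  (1 + (Sa ^+ 2 + Sb ^+ 2 + Sc ^+ 2 + Sd ^+ 2) / 2 - Sa * Sb * Sc * Sd) ^+ 2 /
  (cosh (hdist A B / 2) ^+ 2 * cosh (hdist B C / 2) ^+ 2 *
   cosh (hdist C D / 2) ^+ 2 * cosh (hdist D A / 2) ^+ 2).
Proof.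
move=> [hC [K cK [KA KB KC KD]]] /=.
have [[A0 B0 C0 D0] [h1 h2 _ h4]] := hC.
rewrite cos_half_area//.
have := cos_turns A0 B0 C0 D0; rewrite !sqnorm_turn// re_holonomy.
have [al [be [ga plane]]] := cycle_section cK.
have im0 := im_chords (plane _ KA) (plane _ KB) (plane _ KC) (plane _ KD).
have re0 := re_chords_lt0 (plane _ KA) (plane _ KB) (plane _ KC) (plane _ KD)
  h1 h2 h4.
rewrite re_chords_sinh// !sqnorm_chord//.
have M0 : 0 < 16 * A.2 * B.2 * C.2 * D.2 by rewrite !mulr_gt0.
move: (cosh_gt0 (hdist A B / 2)) (cosh_gt0 (hdist B C / 2)).
move: (cosh_gt0 (hdist C D / 2)) (cosh_gt0 (hdist D A / 2)).
move: (cosh (hdist A B / 2)) (cosh (hdist B C / 2)) (cosh (hdist C D / 2))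
  (cosh (hdist D A / 2)) => Ca Cb Cc Cd c0 d0 a0 b0.
move: (sinh _) (sinh _) (sinh _) (sinh _) => Sa Sb Sc Sd.
move: (cos _ ^+ 2) => t e.
have k0 : 0 < Ca ^+ 2 * Cb ^+ 2 * Cc ^+ 2 * Cd ^+ 2.
  by rewrite !mulr_gt0// exprn_gt0.
have M2 : (16 * A.2 * B.2 * C.2 * D.2) ^+ 2 != 0 by rewrite gt_eqF// exprn_gt0.
apply: (mulIf (lt0r_neq0 k0)); rewrite divfK ?gt_eqF//; apply: (mulIf M2).
transitivity (t * (4 * A.2 * B.2 * Ca ^+ 2 * (4 * B.2 * C.2 * Cb ^+ 2) *
  (4 * C.2 * D.2 * Cc ^+ 2) * (4 * D.2 * A.2 * Cd ^+ 2))); first by ring.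
by rewrite e -exprMn; congr (_ ^+ 2); field.
Qed.

End QuadrilateralArea.

Unset Implicit Arguments.
Set Strict Implicit.

Theorem theorem4p2 (R : realType) (A B C D : R * R)
    (hQ : cyclic_quadrilateral A B C D) :
  let a := hdist A B in
  let b := hdist B C in
  let c := hdist C D in
  let d := hdist D A in
  let S := harea (quadrilateral A B C D) in
  let s := (a + b + c + d) / 2 in
  let eps :=
    (sinh (a / 2) * sinh (b / 2) * sinh (c / 2) * sinh (d / 2)) /
    (cosh ((s - a) / 2) * cosh ((s - b) / 2) *
     cosh ((s - c) / 2) * cosh ((s - d) / 2)) in
  sin (S / 2) ^+ 2 =
    (sinh (s - a) * sinh (s - b) * sinh (s - c) * sinh (s - d)) /
    (4 * cosh (a / 2) ^+ 2 * cosh (b / 2) ^+ 2 *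
     cosh (c / 2) ^+ 2 * cosh (d / 2) ^+ 2) * (1 - eps).
Proof.
move=> a b c d S s eps.
have -> : sin (S / 2) ^+ 2 = 1 - cos (S / 2) ^+ 2.
  by have := cos2Dsin2 (S / 2); lra.
by rewrite /eps /s brahmagupta_of_cos /S cos_half_area_cyclic.
Qed.
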